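(* Let $n\ge2$ and $s\ge2$ be integers. The regular $(n+1)$-polytope $\{4,3^{n-2},4\}_{(s,0^{n-1})}$ is internally self-dual if and only if $s$ is odd.
   Context: The cubic toroid $\{4,3^{n-2},4\}_{(s,0^{n-1})}$ is the abstract regular polytope of rank $n+1$ obtained from the tessellation of $\mathbb R^n$ by unit cubes with vertex set $\mathbb Z^n$ by taking the quotient by the translation group $s\mathbb Z^n$; its vertex set is $(\mathbb Z/s\mathbb Z)^n$. (For $n=2$ it is the toroidal map $\{4,4\}_{(s,0)}$.) Its automorphism group is generated by distinguished involutions $\rho_0,\dots,\rho_n$, induced by the following symmetries of the tessellation: $\rho_0:(x_1,\dots,x_n)\mapsto(1-x_1,x_2,\dots,x_n)$; $\rho_i$ interchanges $x_i$ and $x_{i+1}$ for $1\le i\le n-1$; $\rho_n:(x_1,\dots,x_n)\mapsto(x_1,\dots,x_{n-1},-x_n)$. The base flag has as $i$-face ($0\le i\le n$) the $i$-face containing the vertices $0,e_1,e_1+e_2,\dots,e_1+\cdots+e_i$, where $e_1,\dots,e_n$ is the standard basis. For a regular self-dual polytope $\mathcal P$ of rank $m$ with distinguished generators $\rho_0,\dots,\rho_{m-1}$ of its automorphism group $\Gamma(\mathcal P)$, an automorphism $\alpha$ is dualizing if $\alpha\rho_i=\rho_{m-i-1}\alpha$ for $0\le i\le m-1$; $\mathcal P$ is internally self-dual if it has a dualizing automorphism. (Self-dual means admitting an order-reversing bijection to itself.) *)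

(* Defs.v *)
From HB Require Import structures.
From mathcomp Require Import all_boot all_order all_fingroup all_algebra.

Set Implicit Arguments.
Unset Strict Implicit.
Unset Printing Implicit Defensive.

Import Order.Theory GRing.Theory.
Local Open Scope ring_scope.

(* A polytope is represented by its finite poset of faces, including the least
   face (rank -1) and the greatest face (rank m). *)
Section InternalSelfDuality.
Variables (d : Order.disp_t) (T : finPOrderType d).

Definition automorphism (a : {perm T}) : Prop :=
  forall x y : T, (a x <= a y)%O = (x <= y)%O.

Definition self_dual : Prop :=
  exists f : {perm T}, forall x y : T, (f x <= f y)%O = (y <= x)%O.

Variables (m : nat) (rho : 'I_m -> {perm T}).

(* rev_ord i has value m - i - 1. *)
Definition dualizing (a : {perm T}) : Prop :=
  forall (i : 'I_m) (x : T), a (rho i x) = rho (rev_ord i) (a x).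

(* rho is meant to be the family of distinguished generators of the
   automorphism group of a regular polytope of rank m. *)
Definition internally_self_dual : Prop :=
  self_dual /\ exists2 a : {perm T}, automorphism a & dualizing a.

End InternalSelfDuality.

(* The pair (v, D) is the cube v + \sum_(j in D) [0, e_j], of dimension #|D|.
   Over int these are the faces of the cubic tessellation; over 'Z_s they are
   the orbits of those faces under translation by s Z^n (lemmas cell_le_vertex
   and cell_le_lift below). *)
Definition cell (R : Type) (n : nat) : Type := ('rV[R]_n * {set 'I_n})%type.

(* (v, D) lies in (w, E) when D is contained in E and v = w + \sum_(j in A) e_j
   for some A contained in E :\: D. *)
Definition cell_le (R : nzRingType) (n : nat) (c c' : cell R n) : bool :=
  (c.2 \subset c'.2) &&
  [forall j, (c.1 0 j == c'.1 0 j)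
          || (j \in c'.2 :\: c.2) && (c.1 0 j == c'.1 0 j + 1)].

Definition vertex (R : nzRingType) (n : nat) (c : cell R n) (u : 'rV[R]_n) :=
  cell_le (u, set0) c.

(* The transposition of the coordinates x_i and x_(i+1) (1-based), that is of
   the ordinals i.-1 and i, for 0 < i < n. *)
Definition adj_tperm (n i : nat) : {perm 'I_n} :=
  if (insub i.-1 : option 'I_n, insub i : option 'I_n) is (Some a, Some b)
  then tperm a b else 1%g.

(* The symmetries rho_0, ..., rho_n of the tessellation, acting on points. *)
Definition point_sym (R : nzRingType) (n : nat) (i : 'I_n.+1)
    (x : 'rV[R]_n) : 'rV[R]_n :=
  if i == 0 :> nat then \row_j (if j == 0 :> nat then 1 - x 0 j else x 0 j)
  else if i == n :> nat then
    \row_j (if j.+1 == n :> nat then - x 0 j else x 0 j)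
  else col_perm (adj_tperm n i) x.

(* Their action on cells: a reflection in the j-th coordinate exchanges the two
   end points of the j-th side of (v, D) when j \in D. *)
Definition cell_sym (R : nzRingType) (n : nat) (i : 'I_n.+1)
    (c : cell R n) : cell R n :=
  if i == 0 :> nat then
    (\row_j (if j == 0 :> nat then 1 - c.1 0 j - (j \in c.2)%:R else c.1 0 j),
     c.2)
  else if i == n :> nat then
    (\row_j (if j.+1 == n :> nat then - c.1 0 j - (j \in c.2)%:R else c.1 0 j),
     c.2)
  else (col_perm (adj_tperm n i) c.1, adj_tperm n i @: c.2).

(* The faces of {4,3^(n-2),4}_(s,0^(n-1)): inl false is the least face, inl true
   the greatest one, and inr c a proper face.  'Z_s is Z/sZ for 1 < s only. *)
Definition toroid (n s : nat) : Type := (bool + cell 'Z_s n)%type.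

HB.instance Definition _ n s :=
  Finite.copy (toroid n s) (bool + 'rV['Z_s]_n * {set 'I_n})%type.

Definition toroid_le (n s : nat) (x y : toroid n s) : bool :=
  match x, y with
  | inl false, _ | _, inl true => true
  | inr c, inr c' => cell_le c c'
  | _, _ => false
  end.

Lemma cell_eq (R : nzRingType) (n : nat) (v w : 'rV[R]_n) (D E : {set 'I_n}) :
  (forall j, v 0 j = w 0 j) -> D = E -> (v, D) = (w, E) :> cell R n.
Proof. by move=> vw ->; congr pair; apply/rowP. Qed.

Section CellOrder.
Variables (R : nzRingType) (n : nat).
Implicit Types c : cell R n.

Lemma cell_leP c c' :
  reflect (c.2 \subset c'.2 /\
           forall j, c.1 0 j = c'.1 0 j \/
             [/\ j \in c'.2, j \notin c.2 & c.1 0 j = c'.1 0 j + 1])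
          (cell_le c c').
Proof.
apply: (iffP andP) => -[sub H]; split=> //.
  move=> j; have /orP[/eqP|] := forallP H j; first by left.
  by rewrite inE => /andP[/andP[? ?] /eqP ?]; right; split.
apply/forallP => j; have [->|[jc' jc ->]] := H j; first by rewrite eqxx.
by rewrite inE jc jc' eqxx orbT.
Qed.

Lemma cell_le_refl : reflexive (@cell_le R n).
Proof. by move=> c; apply/cell_leP; split=> // j; left. Qed.

Lemma cell_le_anti : antisymmetric (@cell_le R n).
Proof.
move=> [v D] [w E] /andP[/cell_leP[/= DE H] /cell_leP[/= ED _]].
have eDE : D = E by apply/eqP; rewrite eqEsubset DE ED.
apply: cell_eq => // j.
by have [//|[jE jD]] := H j; rewrite eDE jE in jD.
Qed.

Lemma cell_le_trans : transitive (@cell_le R n).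
Proof.
move=> c2 c1 c3 /cell_leP[s12 H12] /cell_leP[s23 H23].
apply/cell_leP; split=> [|j]; first exact: subset_trans s12 s23.
have [->|[j2 j1 ->]] := H12 j; have [->|[j3 nj2 ->]] := H23 j.
- by left.
- by right; split=> //; apply: contra nj2 => /(subsetP s12).
- by right; split=> //; apply: (subsetP s23).
- by rewrite j2 in nj2.
Qed.

End CellOrder.

Section ToroidOrder.
Variables n s : nat.

Lemma toroid_le_refl : reflexive (@toroid_le n s).
Proof. by case=> [[]|c] //; apply: cell_le_refl. Qed.

Lemma toroid_le_anti : antisymmetric (@toroid_le n s).
Proof. by move=> [[]|c] [[]|c'] //= /cell_le_anti ->. Qed.

Lemma toroid_le_trans : transitive (@toroid_le n s).
Proof. by move=> [[]|c2] [[]|c1] [[]|c3] //=; apply: cell_le_trans. Qed.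

End ToroidOrder.

Fact toroid_display : Order.disp_t. Proof. exact: Order.Disp tt tt. Qed.

HB.instance Definition _ n s :=
  Order.Le_isPOrder.Build toroid_display (toroid n s)
    (@toroid_le_refl n s) (@toroid_le_anti n s) (@toroid_le_trans n s).

Lemma adj_tpermK n i : involutive (adj_tperm n i).
Proof.
move=> j; rewrite /adj_tperm; case: insub => [a|]; last by rewrite !perm1.
by case: insub => [b|]; rewrite ?tpermK ?perm1.
Qed.

Lemma mem_adj_tperm n i j (D : {set 'I_n}) :
  (j \in adj_tperm n i @: D) = (adj_tperm n i j \in D).
Proof. by rewrite -{1}[j](adj_tpermK i) mem_imset //; apply: perm_inj. Qed.

Lemma cell_symK (R : nzRingType) n i : involutive (@cell_sym R n i).
Proof.
move=> [v D]; rewrite /cell_sym; case: (nat_of_ord i == 0%N) => /=.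
  apply: cell_eq => // j; rewrite !mxE; case: eqP => //= _.
  by rewrite !opprD !opprK !addrA subrr add0r addrK.
case: (nat_of_ord i == n) => /=.
  apply: cell_eq => // j; rewrite !mxE; case: eqP => //= _.
  by rewrite opprD !opprK addrK.
apply: cell_eq => [j|]; first by rewrite /= !mxE adj_tpermK.
by apply/setP => j; rewrite /= !mem_adj_tperm adj_tpermK.
Qed.

Definition toroid_sym n s (i : 'I_n.+1) (x : toroid n s) : toroid n s :=
  if x is inr c then inr (cell_sym i c) else x.

Lemma toroid_symK n s i : involutive (@toroid_sym n s i).
Proof. by case=> [b|c] //=; rewrite cell_symK. Qed.

(* The distinguished generators of the automorphism group. *)
Definition toroid_rho n s (i : 'I_n.+1) : {perm toroid n s} :=
  perm (can_inj (@toroid_symK n s i)).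

Lemma cell_le_sym (R : nzRingType) n i (c c' : cell R n) :
  cell_le (cell_sym i c) (cell_sym i c') = cell_le c c'.
Proof.
suff mono (a b : cell R n) : cell_le a b -> cell_le (cell_sym i a) (cell_sym i b).
  by apply/idP/idP => [/mono|/mono //]; rewrite !cell_symK.
case: a b => [v D] [w E] /cell_leP[/= sDE H].
apply/cell_leP; rewrite /cell_sym.
case: (nat_of_ord i == 0%N).
  split=> //= j; rewrite !mxE; case: ifP => [_|_]; last exact: H.
  have [-> | [jE jD ->]] := H j.
    case jD: (j \in D); first by rewrite (subsetP sDE _ jD); left.
    case jE: (j \in E); last by left.
    by right; split=> //; rewrite subr0 subrK.
  by left; rewrite jE (negbTE jD) subr0 opprD addrA.
case: (nat_of_ord i == n).
  split=> //= j; rewrite !mxE; case: ifP => [_|_]; last exact: H.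
  have [-> | [jE jD ->]] := H j.
    case jD: (j \in D); first by rewrite (subsetP sDE _ jD); left.
    case jE: (j \in E); last by left.
    by right; split=> //; rewrite subr0 subrK.
  by left; rewrite jE (negbTE jD) subr0 opprD.
split=> /= [|j]; first exact: imsetS.
by rewrite !mxE !mem_adj_tperm; apply: H.
Qed.

Lemma toroid_rho_automorphism n s i : automorphism (@toroid_rho n s i).
Proof.
by move=> [[]|c] [[]|c']; rewrite !permE // /Order.le /= cell_le_sym.
Qed.

(* Incidence in the tessellation is inclusion of vertex sets. *)
Lemma cell_le_vertex n (c c' : cell int n) :
  cell_le c c' <-> forall u, vertex c u -> vertex c' u.
Proof.
split=> [cc' u uc|H]; first exact: cell_le_trans uc cc'.
have vtx (A : {set 'I_n}) (b : cell int n) :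
    A \subset b.2 -> vertex b (\row_j (b.1 0 j + (j \in A)%:R)).
  move=> sA; apply/cell_leP; split=> /= [|j]; first exact: sub0set.
  rewrite mxE inE; case jA: (j \in A); last by left; rewrite addr0.
  by right; split=> //; apply: (subsetP sA).
have /cell_leP[/= _ H0] := H _ (vtx set0 c (sub0set _)).
have /cell_leP[/= _ H1] := H _ (vtx c.2 c (subxx _)).
have neq1 (x : int) : x + 1 = x -> False.
  by move/eqP; rewrite -subr_eq0 [x + 1]addrC addrK.
have neq2 (x : int) : x + 1 + 1 = x -> False.
  by move/eqP; rewrite -addrA -subr_eq0 [x + _]addrC addrK.
apply/cell_leP; split=> [|j].
  apply/subsetP => j jc; have := H0 j; have := H1 j; rewrite !mxE jc inE addr0.
  by move=> [e1|[]//] [e0|[]//]; move: e1; rewrite e0 => /neq1.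
have := H0 j; have := H1 j; rewrite !mxE !inE addr0.
move=> e1 [->|[jc' _ e0]]; first by left.
right; split=> //; apply/negP => jc; move: e1; rewrite jc e0.
by case=> [/neq2|[_ _ /addIr /neq1]].
Qed.

Lemma vertex_sym n i (c : cell int n) u :
  vertex (cell_sym i c) (point_sym i u) = vertex c u.
Proof.
rewrite /vertex -(cell_le_sym i (u, set0)); congr cell_le.
rewrite /point_sym /cell_sym; case: (nat_of_ord i == 0%N); last case: (nat_of_ord i == n).
- by apply: cell_eq => // j; rewrite !mxE inE subr0.
- by apply: cell_eq => // j; rewrite !mxE inE subr0.
- by rewrite imset0.
Qed.

Definition cell_mod s n (c : cell int n) : cell 'Z_s n :=
  (map_mx (intr : int -> 'Z_s) c.1, c.2).

Lemma intr_Zp_eq0 s (z : int) : (1 < s)%N -> (z%:~R == 0 :> 'Z_s) = (s %| z)%Z.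
Proof.
move=> s1; have nat0 k : (k%:R == 0 :> 'Z_s) = (s %| k)%N.
  by rewrite -val_eqE /= val_Zp_nat.
by rewrite dvdzE; case: z => k; rewrite ?NegzE ?mulrNz ?oppr_eq0 -pmulrn nat0 ?abszN.
Qed.

Lemma cell_mod_eq s n (c c' : cell int n) : (1 < s)%N ->
  cell_mod s c = cell_mod s c' <->
  c.2 = c'.2 /\ exists t : 'rV[int]_n, c'.1 = c.1 + s%:Z *: t.
Proof.
case: c c' => [v D] [w E] s1; rewrite /cell_mod /=; split.
  case=> /rowP vw ->; split=> //.
  have dv j : (s %| (w 0%R j - v 0%R j)%R)%Z.
    have := vw j; rewrite !mxE => /eqP; rewrite eq_sym -subr_eq0 -rmorphB /=.
    by rewrite intr_Zp_eq0.
  exists (\row_j ((w 0%R j - v 0%R j)%R %/ s)%Z); apply/rowP => j.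
  by rewrite !mxE mulrC divzK // addrC subrK.
case=> -> [t ->]; apply: cell_eq => // j.
by rewrite !mxE rmorphD rmorphM /= -pmulrn pchar_Zp // mul0r addr0.
Qed.

Lemma cell_mod_surj s n (x : cell 'Z_s n) : exists c, cell_mod s c = x.
Proof.
case: x => v D; exists (\row_j (v 0 j : nat)%:Z, D).
by apply: cell_eq => // j; rewrite !mxE; exact: natr_Zp.
Qed.

Lemma cell_mod_sym s n i (c : cell int n) :
  cell_mod s (cell_sym i c) = cell_sym i (cell_mod s c).
Proof.
rewrite /cell_mod /cell_sym; case: (nat_of_ord i == 0%N); last case: (nat_of_ord i == n); apply: cell_eq => // j; rewrite !mxE.
- by case: ifP => // _; rewrite !rmorphB rmorph1 rmorph_nat.
- by case: ifP => // _; rewrite rmorphB rmorphN rmorph_nat.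
- by [].
Qed.

(* Incidence in the toroid is incidence of some representatives. *)
Lemma cell_le_lift s n (x y : cell 'Z_s n) :
  cell_le x y <->
  exists c c', [/\ cell_mod s c = x, cell_mod s c' = y & cell_le c c'].
Proof.
split; last first.
  move=> [c [c' [<- <- /cell_leP[sub H]]]]; apply/cell_leP; split=> // j.
  rewrite !mxE; have [->|[jc' jc ->]] := H j; first by left.
  by right; split=> //; rewrite rmorphD rmorph1.
have [[w E] <-] := cell_mod_surj y; case: x => v D /cell_leP[/= sDE H].
exists (\row_j (w 0 j + (v 0 j != (w 0 j)%:~R)%:R), D), (w, E); split=> //.
  apply: cell_eq => // j; rewrite !mxE rmorphD rmorph_nat.
  have := H j; rewrite mxE; case: eqP => [->|vw]; first by rewrite addr0.
  by case=> [/vw|[_ _ ->]].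
apply/cell_leP; split=> //= j; rewrite mxE.
have := H j; rewrite mxE; case: eqP => [_|vw]; first by left; rewrite addr0.
by case=> [/vw|[? ? _]]; last by right.
Qed.

(* The k-face of the base flag: its vertices include 0, e_1, ..., e_1 + ... + e_k. *)
Definition base_face n s (k : 'I_n.+1) : toroid n s :=
  inr (0, [set j : 'I_n | j < k]%N).

Lemma toroid_rho_base n s (i k : 'I_n.+1) : (1 < n)%N ->
  (toroid_rho s i (base_face s k) == base_face s k) = (k != i).
Proof.
move=> n1; rewrite permE /toroid_sym /base_face.
have n0 : (0 < n)%N by apply: ltnW.
have rowE (f : 'I_n -> 'Z_s) (D : {set 'I_n}) j0 :
    (forall j, j != j0 -> f j = 0) ->
    ((inr (\row_j f j, D) : toroid n s) == inr (0, D)) = (f j0 == 0).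
  move=> fE; apply/eqP/eqP => [[/rowP /(_ j0)]|f0]; first by rewrite !mxE.
  congr inr; apply: cell_eq => // j; rewrite !mxE.
  by case: (eqVneq j j0) => [->|/fE].
rewrite -(inj_eq val_inj) /=; have [i0|i0] := eqVneq (nat_of_ord i) 0%N.
  rewrite /cell_sym i0 eqxx (rowE _ _ (Ordinal n0)) => [|j jn]; last first.
    by rewrite mxE ifN.
  by rewrite mxE /= inE /= subr0; case: (nat_of_ord k) => [|m];
    rewrite ?subr0 ?subrr ?oner_eq0 ?eqxx.
have nK : n.-1.+1 = n by apply: prednK.
have [iN|iN] := eqVneq (nat_of_ord i) n.
  have ltn' : (n.-1 < n)%N by rewrite nK.
  rewrite /cell_sym (negPf i0) iN eqxx (rowE _ _ (Ordinal ltn')); last first.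
    move=> j jn; rewrite mxE ifN //; apply: contra jn => /eqP jn.
    by apply/eqP/val_inj; rewrite /= -[LHS]/(j.+1.-1) jn.
  rewrite mxE /= inE /= nK eqxx oppr0 sub0r oppr_eq0.
  have -> : (nat_of_ord k != n) = ~~ (n <= k)%N.
    by rewrite -ltnNge ltn_neqAle -ltnS ltn_ord andbT.
  by case: (n <= k)%N; rewrite ?oner_eq0 ?eqxx.
have ltin : (i < n)%N by rewrite ltn_neqAle iN -ltnS ltn_ord.
have iK : i.-1.+1 = i by rewrite prednK // lt0n.
have ltin' : (i.-1 < n)%N by apply: leq_ltn_trans (leq_pred _) ltin.
have tE : adj_tperm n i = tperm (Ordinal ltin') (Ordinal ltin).
  by rewrite /adj_tperm !insubT.
rewrite /cell_sym (negPf i0) (negPf iN) /= tE.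
apply/eqP/idP => [[_ /setP /(_ (Ordinal ltin))]|ki].
  rewrite -tE mem_adj_tperm tE tpermR !inE /=.
  by apply: contra_eqN => /eqP ->; rewrite iK leqnn ltnn.
congr inr; apply: cell_eq => [j|]; first by rewrite !mxE.
apply/setP => j; rewrite -tE mem_adj_tperm tE !inE.
have lt_ik : (i.-1 < k)%N = (i < k)%N.
  by rewrite iK leq_eqVlt eq_sym (negPf ki).
by case: tpermP => [->|->|].
Qed.

(* Main.v *)
Require Import Defs.
From mathcomp Require Import all_boot all_order all_fingroup all_algebra.

(** Write [Z_s] for the integers modulo [s].

    A dualizing automorphism [a] conjugates [rho_0] to [rho_n].  It fixes the
    least face, hence permutes the vertices, and so [rho_0] and [rho_n] fix
    equally many vertices.  Now [rho_n] fixes the vertex [0], whereas a vertex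
    [x] fixed by [rho_0] satisfies [x_1 = 1 - x_1]; when [s] is even, [1] is not
    of the form [2 x_1] in [Z_s] ([Zp_even_half]), so no such automorphism
    exists.

    When [s] is odd, [2] has an inverse [h] in [Z_s] ([Zp_odd_half]), and the
    isometry [x |-> (h - x_n, ..., h - x_1)] is dualizing ([flip_cell_sym]): it
    exchanges the reflection of the first coordinate in [1/2] with that of the
    last coordinate in [0], and it reverses the list of transpositions of
    adjacent coordinates.

    Self-duality holds for every [s]: the tessellation by cubes centred at the
    integer points is a dual of the given one, and the translation by
    [(1/2, ..., 1/2)] identifies the two.  Preceded by [x |-> - x], this
    duality becomes the involution [(v, D) |-> (- v, ~: D)] ([dual_cell_le]). *)

Set Implicit Arguments.
Unset Strict Implicit.
Unset Printing Implicit Defensive.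

Import Order.Theory GRing.Theory.
Local Open Scope ring_scope.

Section CellMaps.
Variables (R : nzRingType) (n : nat).
Implicit Types c : cell R n.

Definition dual_cell c : cell R n := (- c.1, ~: c.2).

Lemma dual_cellK : involutive dual_cell.
Proof. by move=> [v D]; rewrite /dual_cell /= opprK setCK. Qed.

(** The corner [v = w + \sum_(j in A) e_j] becomes
    [- w = - v + \sum_(j in A) e_j], and the set [E :\: D] of admissible
    directions is the same for the complements of [E] and [D]. *)
Lemma dual_cell_le c c' : cell_le (dual_cell c) (dual_cell c') = cell_le c' c.
Proof.
suff mono a b : cell_le b a -> cell_le (dual_cell a) (dual_cell b).
  by apply/idP/idP => [/mono|/mono //]; rewrite !dual_cellK.
case: a b => [w E] [v D] /cell_leP[/= sDE H].
apply/cell_leP; split=> /= [|j]; first by rewrite setCS.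
rewrite !mxE !inE; have [->|[jE jD ->]] := H j; first by left.
by right; rewrite jE; split=> //; rewrite opprD subrK.
Qed.

(** The effect on cells of the isometry [x |-> (h - x_n, ..., h - x_1)].  The
    image of the side [[v_j, v_j + 1]] starts at [h - v_j - 1], whence the
    correction for the directions in [D]. *)
Definition flip_cell (h : R) c : cell R n :=
  (\row_j (h - c.1 0 (rev_ord j) - (rev_ord j \in c.2)%:R),
   [set j | rev_ord j \in c.2]).

Lemma flip_cellK h : involutive (flip_cell h).
Proof.
move=> [v D]; apply: cell_eq => [j|] /=; last first.
  by apply/setP => j; rewrite !inE rev_ordK.
by rewrite !mxE !inE rev_ordK !opprD !opprK !addrA subrr add0r addrK.
Qed.

Lemma flip_cell_le h c c' :
  cell_le (flip_cell h c) (flip_cell h c') = cell_le c c'.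
Proof.
suff mono a b : cell_le a b -> cell_le (flip_cell h a) (flip_cell h b).
  by apply/idP/idP => [/mono|/mono //]; rewrite !flip_cellK.
case: a b => [v D] [w E] /cell_leP[/= sDE H].
apply/cell_leP; split=> /= [|j].
  by apply/subsetP => j; rewrite !inE => /(subsetP sDE).
rewrite !mxE !inE; have [->|[jE jD ->]] := H (rev_ord j).
  case jD: (rev_ord j \in D); first by rewrite (subsetP sDE _ jD); left.
  case jE: (rev_ord j \in E); last by left.
  by right; split=> //; rewrite subr0 subrK.
by left; rewrite jE (negbTE jD) subr0 opprD addrA.
Qed.

End CellMaps.

Lemma adj_tperm_rev n i (j : 'I_n) : (0 < i < n)%N ->
  adj_tperm n i (rev_ord j) = rev_ord (adj_tperm n (n - i) j).
Proof.
case/andP=> i0 ltin.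
have adjE k (kn : (k < n)%N) :
    adj_tperm n k =
    tperm (Ordinal (leq_ltn_trans (leq_pred k) kn)) (Ordinal kn).
  rewrite /adj_tperm !insubT => [|kn'].
    exact: leq_ltn_trans (leq_pred k) kn.
  by congr tperm; apply: val_inj.
have nin : (n - i < n)%N by rewrite ltn_subrL i0 (ltn_trans i0).
rewrite !adjE (inj_tperm _ _ _ rev_ord_inj) tpermC.
congr (tperm _ _ _); apply: val_inj => /=.
  by rewrite prednK ?subn_gt0 // subKn // ltnW.
by rewrite subnS subKn // ltnW.
Qed.

(** The equation [h + h = 1] is what makes the two reflections correspond:
    [h - (1 - x) = - (h - x)] and [h - (- x) = 1 - (h - x)]. *)
Lemma flip_cell_sym (R : nzRingType) n (h : R) (i : 'I_n.+1) (c : cell R n) :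
  (0 < n)%N -> h + h = 1 ->
  flip_cell h (cell_sym i c) = cell_sym (rev_ord i) (flip_cell h c).
Proof.
move=> n0 hh; case: c => v D.
have hN : h - 1 = - h by rewrite -hh opprD addNKr.
have hP : 1 - h = h by rewrite -hh addrK.
have revE (j : 'I_n) : (rev_ord j == 0 :> nat) = (j.+1 == n).
  by rewrite /= subn_eq0 eqn_leq ltn_ord.
have revE' (j : 'I_n) : ((rev_ord j).+1 == n) = (j == 0 :> nat).
  by rewrite -revE rev_ordK.
rewrite /cell_sym /= subSS.
have [i0|i0] := eqVneq (nat_of_ord i) 0%N.
  rewrite i0 subn0 (gtn_eqF n0) eqxx; apply: cell_eq => // j.
  rewrite !mxE !inE revE; case: ifP => // _.
  by rewrite !opprD !opprK !addrA hN.
have [iN|iN] := eqVneq (nat_of_ord i) n.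
  rewrite iN subnn eqxx; apply: cell_eq => // j.
  rewrite !mxE !inE revE'; case: ifP => // _.
  by rewrite !opprD !opprK !addrA hP.
have ltin : (i < n)%N by rewrite ltn_neqAle iN -ltnS ltn_ord.
have ii : (0 < i < n)%N by rewrite lt0n i0.
have -> : (n - i == 0)%N = false by rewrite subn_eq0 leqNgt ltin.
have -> : (n - i == n)%N = false.
  by rewrite ltn_eqF // ltn_subrL n0 lt0n i0.
apply: cell_eq => [j|] /=; first by rewrite !mxE mem_adj_tperm adj_tperm_rev.
by apply/setP => j; rewrite inE !mem_adj_tperm inE adj_tperm_rev.
Qed.

Section Toroid.
Variables n s : nat.

Lemma toroid_self_dual : self_dual (toroid n s).
Proof.
pose f (x : toroid n s) : toroid n s :=
  match x with inl b => inl (~~ b) | inr c => inr (dual_cell c) end.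
have fK : involutive f by case=> [b|c] /=; rewrite ?negbK ?dual_cellK.
exists (perm (can_inj fK)) => x y; rewrite !permE.
by case: x y => [[]|c] [[]|c'] //; apply: dual_cell_le.
Qed.

Lemma flip_dualizing (h : 'Z_s) : (0 < n)%N -> h + h = 1 ->
  exists2 a : {perm toroid n s}, automorphism a & dualizing (@toroid_rho n s) a.
Proof.
move=> n0 hh.
pose f (x : toroid n s) : toroid n s :=
  if x is inr c then inr (flip_cell h c) else x.
have fK : involutive f by case=> [b|c] //=; rewrite flip_cellK.
exists (perm (can_inj fK)) => [x y|i x]; rewrite !permE.
  by case: x y => [[]|c] [[]|c'] //; apply: flip_cell_le.
by case: x => [b|c] //=; rewrite flip_cell_sym.
Qed.

(** Vertices are the minimal elements above the least face, which an
    automorphism fixes. *)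
Lemma automorphism_vertex (a : {perm toroid n s}) (u : 'rV['Z_s]_n) :
  automorphism a -> exists v, a (inr (u, set0)) = inr (v, set0).
Proof.
move=> aut; pose bot : toroid n s := inl false.
have a_bot : a bot = bot.
  apply/le_anti/andP; split=> //.
  by rewrite -[leRHS](permKV a) aut.
have below x : (x <= inr (u, set0) :> toroid n s)%O ->
    x = bot \/ x = inr (u, set0).
  case: x => [[]//|[v D]] /=; first by left.
  case/cell_leP=> /=; rewrite subset0 => /eqP-> H; right.
  by congr inr; apply: cell_eq => // j; have [|[]] := H j; rewrite ?inE.
case au: (a (inr (u, set0))) => [[]|[v D]].
- (* Every face would lie below the vertex [u], in particular the top one. *)
  have : (inl true <= inr (u, set0) :> toroid n s)%O.
    by rewrite -aut au; case: (a _) => [[]|].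
  by [].
- by move: au; rewrite -/bot -a_bot => /perm_inj.
(* Otherwise the corner [v] of the image pulls back to a face below [u]. *)
exists v; pose x := (a^-1)%g (inr (v, set0)).
have ax : a x = inr (v, set0) by rewrite permKV.
have /below : (x <= inr (u, set0))%O.
  rewrite -aut ax au; apply/cell_leP; split=> /= [|j]; first exact: sub0set.
  by left.
by case=> xE; move: ax; rewrite xE ?a_bot // au.
Qed.

Lemma Zp_odd_half : (1 < s)%N -> odd s -> exists h : 'Z_s, h + h = 1.
Proof.
move=> s1 s_odd; exists (s.+1)./2%:R.
rewrite -natrD addnn even_halfK /= ?s_odd //.
by rewrite mulrSr pchar_Zp // add0r.
Qed.

Lemma Zp_even_half (x : 'Z_s) : (1 < s)%N -> x + x = 1 -> odd s.
Proof.
move=> s1 xx; apply: contraT => s_even.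
(* Multiplying by [s./2] turns [2 * x = 1] into [0 = s./2]. *)
have : s./2%:R * (x + x) = 0.
  by rewrite mulrDr -mulrDl -natrD addnn even_halfK // pchar_Zp // mul0r.
rewrite xx mulr1 => /eqP; rewrite -val_eqE /= val_Zp_nat // modn_small.
  by rewrite -leqn0 leqNgt half_gt0 s1.
by rewrite ltn_half_double -addnn -[ltnLHS]addn0 ltn_add2l ltnW.
Qed.

End Toroid.

Theorem theorem5p10 (n s : nat) (hn : (2 <= n)%N) (hs : (2 <= s)%N) :
  internally_self_dual (@toroid_rho n s) <-> odd s.
Proof.
have n0 : (0 < n)%N by apply: ltnW.
split=> [[_ [a aut dua]]|/(Zp_odd_half hs)[h hh]]; last first.
  by split; [apply: toroid_self_dual | apply: flip_dualizing hh].
have [v av] := automorphism_vertex 0 aut.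
have := dua ord_max (inr (0, set0)).
have -> : toroid_rho s (ord_max : 'I_n.+1) (inr (0, set0)) = inr (0, set0).
  rewrite permE /= /cell_sym /= (gtn_eqF n0) eqxx; congr inr.
  by apply: cell_eq => // j; rewrite !mxE inE subr0 oppr0 if_same.
rewrite av permE /= /cell_sym /= subnn eqxx => -[/rowP/(_ (Ordinal n0))].
rewrite !mxE inE /= subr0 => vE.
by apply: (@Zp_even_half s (v 0 (Ordinal n0)) hs); rewrite {1}vE subrK.
Qed.
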